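(* Suppose a map $f:X\to Y$ between uniform spaces generates the uniform structure on $Y$, has chain lifting, and has strong approximate uniqueness of chain lifts. Then $f$ is approximated by uniform covering maps.
   Context: For a function $f:X\to Y$ and $E\subset X\times X$ put $f(E)=\{(f(x),f(y)):(x,y)\in E\}$. For uniform spaces $X,Y$, $f$ generates the uniform structure on $Y$ if $\{f(E): E \text{ an entourage of } X\}$ is a basis of that structure. For $E\subset X\times X$, an $E$-chain is a finite sequence $x_1,\ldots,x_n$ with $(x_i,x_{i+1})\in E$ for all $i<n$. Two chains $x_1,\ldots,x_n$ and $y_1,\ldots,y_n$ are $E$-close if $(x_i,y_i)\in E$ for all $i\le n$. Images of chains are taken termwise. - $f$ has chain lifting if for every entourage $E$ of $X$ there is an entourage $F$ of $X$ such that for every $x\in X$, any $f(F)$-chain in $Y$ starting at $f(x)$ lifts to an $E$-chain in $X$ starting at $x$. - $f$ has uniqueness of chain lifts if for every entourage $E$ of $X$ there is an entourage $F\subset E$ such that any two $F$-chains in $X$ starting at the same point with identical images under $f$ are equal. - $f$ is a uniform covering map if it generates the uniform structure on $Y$ and has chain lifting and uniqueness of chain lifts. - $f$ has strong approximate uniqueness of chain lifts if for every entourage $E$ of $X$ there is an entourage $F\subset E$ such that any two $F$-chains in $X$ starting at the same point with identical images under $f$ are $F$-close. - $f$ is approximated by uniform covering maps if for every entourage $E$ of $X$ there is an entourage $F\subset E$ such that $f$ factors as $X\xrightarrow{h_F}Z_F\xrightarrow{g_F}Y$, where $Z_F$ is a uniform space, $h_F$ is uniformly continuous with $F$-bounded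 fibers (i.e. $h_F^{-1}(z)\times h_F^{-1}(z)\subset F$ for all $z\in Z_F$), and $g_F$ is a uniform covering map. *)

(* Defs.v *)
From HB Require Import structures.
From mathcomp Require Import all_boot all_order all_classical.
From mathcomp Require Import topology.

Set Implicit Arguments.
Unset Strict Implicit.
Unset Printing Implicit Defensive.

Local Open Scope classical_set_scope.

(* [uniformType] does not include the Hausdorff (separation) axiom. *)

Definition rel_image (X Y : Type) (f : X -> Y) (E : set (X * X)) :
    set (Y * Y) :=
  [set (f xy.1, f xy.2) | xy in E].

(* A (nonempty) chain is given by its first point [x] and the sequence [s] of
   the remaining ones: it is [x :: s]. *)
Definition chain_from (X : Type) (E : set (X * X)) (x : X) (s : seq X) : Prop :=
  path (fun a b => (a, b) \in E) x s.

(* [all2] also requires the two sequences to have the same length. *)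
Definition close_chains (X : Type) (E : set (X * X)) (s t : seq X) : Prop :=
  all2 (fun a b => (a, b) \in E) s t.

Section UniformMaps.
Variables (X Y : uniformType) (f : X -> Y).

Definition generates_uniformity : Prop :=
  @entourage Y = filter_from (@entourage X) (rel_image f).

Definition chain_lifting : Prop :=
  forall E : set (X * X), entourage E ->
  exists F : set (X * X), entourage F /\
    forall (x : X) (t : seq Y), chain_from (rel_image f F) (f x) t ->
    exists s : seq X, chain_from E x s /\ map f (x :: s) = f x :: t.

Definition unique_chain_lifts : Prop :=
  forall E : set (X * X), entourage E ->
  exists F : set (X * X), [/\ entourage F, F `<=` E &
    forall (x : X) (s t : seq X),
      chain_from F x s -> chain_from F x t ->
      map f (x :: s) = map f (x :: t) -> x :: s = x :: t].

Definition strong_approx_unique_chain_lifts : Prop :=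
  forall E : set (X * X), entourage E ->
  exists F : set (X * X), [/\ entourage F, F `<=` E &
    forall (x : X) (s t : seq X),
      chain_from F x s -> chain_from F x t ->
      map f (x :: s) = map f (x :: t) -> close_chains F (x :: s) (x :: t)].

Definition uniform_covering_map : Prop :=
  [/\ generates_uniformity, chain_lifting & unique_chain_lifts].

End UniformMaps.

Definition bounded_fibers (X Z : Type) (F : set (X * X)) (h : X -> Z) : Prop :=
  forall z : Z, (h @^-1` [set z]) `*` (h @^-1` [set z]) `<=` F.

Definition approximated_by_uniform_covering_maps (X Y : uniformType)
    (f : X -> Y) : Prop :=
  forall E : set (X * X), entourage E ->
  exists F : set (X * X), [/\ entourage F, F `<=` E &
    exists (Z : uniformType) (h : X -> Z) (g : Z -> Y),
      [/\ f = g \o h, unif_continuous h, bounded_fibers F h &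
          uniform_covering_map g]].

(* Main.v *)
(* Choose F as in strong approximate uniqueness of chain lifts. Comparing
   F-chains of length two inside one fiber of f shows that F restricts to an
   equivalence relation on each fiber. Let h be the quotient map. A chain of
   h(D) can be lifted to X step by step: a jump between equivalent points is
   absorbed by lifting the next step through f from the actual end point, and
   the end point of the lift is again equivalent to the prescribed one because
   F-chains with equal images stay F-close. Hence the sets h(D) form a basis of
   a uniform structure on the quotient, and the induced map to Y inherits
   generation and chain lifting from f, while unique lifting holds since
   F-close points of one fiber have been identified. *)

Require Import Defs.
From HB Require Import structures.
From mathcomp Require Import all_boot all_order all_classical.
From mathcomp Require Import topology.

Set Implicit Arguments.
Unset Strict Implicit.
Unset Printing Implicit Defensive.

Local Open Scope classical_set_scope.
Local Open Scope quotient_scope.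

(** * Images of relations and lifting of chains *)

Lemma rel_image_comp (X Z Y : Type) (h : X -> Z) (g : Z -> Y)
    (E : set (X * X)) :
  rel_image (g \o h) E = rel_image g (rel_image h E).
Proof. by rewrite /rel_image image_comp. Qed.

Lemma rel_imageS (X Y : Type) (f : X -> Y) (E F : set (X * X)) :
  E `<=` F -> rel_image f E `<=` rel_image f F.
Proof. exact: image_subset. Qed.

Lemma sub_chain_from (X : Type) (E F : set (X * X)) (x : X) (s : seq X) :
  E `<=` F -> chain_from E x s -> chain_from F x s.
Proof.
by move=> EF; apply: sub_path => a b /set_mem Eab; exact/mem_set/EF.
Qed.

Lemma chain_from_map (X Y : Type) (f : X -> Y) (E : set (X * X)) (x : X)
    (s : seq X) :
  chain_from E x s -> chain_from (rel_image f E) (f x) (map f s).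
Proof.
rewrite /chain_from path_map; apply: sub_path => a b /set_mem Eab.
by apply/mem_set; exists (a, b).
Qed.

(** Chain lifting for one step, from any point of the fiber. No uniform structure on [Z] is
    involved, so this makes sense before the quotient has one. *)
Definition lifts_steps (X Z : Type) (h : X -> Z) (D E : set (X * X)) : Prop :=
  forall x z, rel_image h D (h x, z) -> exists2 x', E (x, x') & h x' = z.

Lemma lifts_steps_chain (X Z : Type) (h : X -> Z) (D E : set (X * X)) :
  lifts_steps h D E -> forall x t, chain_from (rel_image h D) (h x) t ->
  exists2 s, chain_from E x s & map h s = t.
Proof.
move=> DE x t; elim: t x => [|z t IH] x /=; first by exists [::].
case/andP=> /set_mem/DE[x' Exx' <-] /IH[s Es <-]; exists (x' :: s) => //.
by apply/andP; split => //; exact/mem_set.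
Qed.

Lemma chain_lifting_steps (X Y : uniformType) (f : X -> Y) (E : set (X * X)) :
  chain_lifting f -> entourage E ->
  exists2 D, entourage D & lifts_steps f D E.
Proof.
move=> fl /fl[D [entD Dl]]; exists D => // x y Dxy.
have [|s [Es [fs]]] := Dl x [:: y].
  by apply/andP; split => //; exact/mem_set.
case: s fs Es => [|x' [|//]] //= [<-] /andP[/set_mem Exx' _].
by exists x'.
Qed.

(* A copy of [Z] meant to carry the uniform structure generated by the images of
   the entourages of [X]; step lifting is what yields the composition axiom. *)
Definition image_uniform (X : uniformType) (Z : choiceType) (h : X -> Z)
    (h_surj : forall z, exists x, h x = z)
    (h_lift : forall E, entourage E ->
      exists2 D, entourage D & lifts_steps h D E) : Type := Z.

Definition image_entourage (X : uniformType) (Z : Type) (h : X -> Z) :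
  set_system (Z * Z) := filter_from (@entourage X) (rel_image h).

Lemma image_entourage_filter (X : uniformType) (Z : Type) (h : X -> Z) :
  Filter (image_entourage h).
Proof.
apply: filter_from_filter; first by exists setT; exact: entourageT.
move=> E F entE entF; exists (E `&` F); first exact: filterI.
by rewrite subsetI; split; apply: rel_imageS => ? [].
Qed.

Lemma image_entourage_diagonal (X : uniformType) (Z : Type) (h : X -> Z) :
  (forall z, exists x, h x = z) ->
  forall A, image_entourage h A -> diagonal `<=` A.
Proof.
move=> h_surj A [E entE EA] [z z'] /diagonalP <-; have [x <-] := h_surj z.
by apply: EA; exists (x, x) => //; exact: entourage_refl.
Qed.

Lemma image_entourage_inv (X : uniformType) (Z : Type) (h : X -> Z) :
  forall A, image_entourage h A -> image_entourage h (A^-1)%relation.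
Proof.
move=> A [E entE EA]; exists (E^-1)%relation; first exact: entourage_inv.
by move=> _ [[x y] /= Eyx <-]; apply: EA; exists (y, x).
Qed.

Lemma image_entourage_split (X : uniformType) (Z : Type) (h : X -> Z) :
  (forall E, entourage E -> exists2 D, entourage D & lifts_steps h D E) ->
  forall A, image_entourage h A ->
  exists2 B, image_entourage h B & (B \; B `<=` A)%relation.
Proof.
move=> h_lift A [E entE EA].
have [D entD DE] := h_lift _ (entourage_split_ent entE).
exists (rel_image h (D `&` split_ent E)).
  by exists (D `&` split_ent E) => //; exact: filterI.
move=> [_ w] [_ /= [[x y] /= [_ Exy] [<- <-]]].
(* The second pair may come from another point over [h y]; lifting it afresh from [y] makes the two
   steps composable in [X]. *)
move=> /(rel_imageS (@subIsetl _ _ _))/DE[y' Eyy' <-].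
by apply: EA; exists (x, y') => //; exact: entourage_split Exy Eyy'.
Qed.

HB.instance Definition _ (X : uniformType) (Z : choiceType) (h : X -> Z)
    h_surj h_lift :=
  Choice.copy (@image_uniform X Z h h_surj h_lift) Z.

HB.instance Definition _ (X : uniformType) (Z : choiceType) (h : X -> Z)
    h_surj h_lift :=
  isUniform.Build (@image_uniform X Z h h_surj h_lift)
    (image_entourage_filter h) (image_entourage_diagonal h_surj)
    (@image_entourage_inv X Z h) (image_entourage_split h_lift).

(** * Generating maps and the right factor of a composition *)

Lemma generates_uniformity_entourage (X Y : uniformType) (f : X -> Y)
    (E : set (X * X)) :
  generates_uniformity f -> entourage E -> entourage (rel_image f E).
Proof. by move=> ->; exists E. Qed.

(** The image of the full relation is an entourage, so it contains the diagonal of [Y]. *)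
Lemma generates_uniformity_surj (X Y : uniformType) (f : X -> Y) :
  generates_uniformity f -> forall y, exists x, f x = y.
Proof.
move=> fg y.
have [[x x'] _ [<- _]] := entourage_refl y
  (generates_uniformity_entourage fg entourageT).
by exists x.
Qed.

Lemma generates_uniformity_unif_continuous (X Y : uniformType) (f : X -> Y) :
  generates_uniformity f -> unif_continuous f.
Proof.
move=> fg A; rewrite fg => -[E entE EA]; apply: filterS entE => xy Exy.
by apply: EA; exists xy.
Qed.

Lemma generates_uniformity_compr (X Z Y : uniformType) (h : X -> Z)
    (g : Z -> Y) :
  generates_uniformity h -> generates_uniformity (g \o h) ->
  generates_uniformity g.
Proof.
move=> hg ghg; rewrite /generates_uniformity ghg hg; apply/seteqP; split.
  move=> A [E entE EA]; exists (rel_image h E); first by exists E.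
  by rewrite -rel_image_comp.
move=> A [B [E entE EB] BA]; exists E => //; rewrite rel_image_comp.
exact: subset_trans (rel_imageS EB) BA.
Qed.

Lemma chain_lifting_compr (X Z Y : uniformType) (h : X -> Z) (g : Z -> Y) :
  generates_uniformity h -> chain_lifting (g \o h) -> chain_lifting g.
Proof.
move=> hg ghl A; rewrite hg => -[E entE EA].
have [D [entD DE]] := ghl E entE.
exists (rel_image h D); split; first by exists D.
move=> z t; have [x <-] := generates_uniformity_surj hg z.
(* Lift all the way to [X], then push the lift down to [Z]. *)
rewrite -rel_image_comp => /DE[s [Es st]]; exists (map h s); split.
  exact/(sub_chain_from EA)/chain_from_map.
by rewrite -map_cons -map_comp.
Qed.

(** * Consequences of closeness of lifts *)

Definition close_lifts (X Y : Type) (f : X -> Y) (F : set (X * X)) : Prop :=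
  forall x s t, chain_from F x s -> chain_from F x t ->
    map f (x :: s) = map f (x :: t) -> close_chains F (x :: s) (x :: t).

(** The Euclidean property on a fiber: with reflexivity it yields symmetry ([z = x]), and then
    transitivity. *)
Lemma close_lifts_fiber (X : uniformType) (Y : Type) (f : X -> Y)
    (F : set (X * X)) (x y z : X) :
  close_lifts f F -> F (x, y) -> F (x, z) ->
  f x = f y -> f x = f z -> F (y, z).
Proof.
move=> Fu Fxy Fxz fxy fxz.
have /and3P[_ /set_mem//] : close_chains F [:: x; y] [:: x; z].
by apply: Fu; rewrite /chain_from /= ?andbT ?mem_set// -fxy -fxz.
Qed.

Lemma close_lifts_sym (X : uniformType) (Y : Type) (f : X -> Y)
    (F : set (X * X)) (x y : X) :
  entourage F -> close_lifts f F -> F (x, y) -> f x = f y -> F (y, x).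
Proof.
move=> entF Fu Fxy fxy; apply: (close_lifts_fiber Fu Fxy) => //.
exact: entourage_refl.
Qed.

Lemma close_lifts_step (X : uniformType) (Y : Type) (f : X -> Y)
    (F : set (X * X)) (x y y' x' : X) :
  entourage F -> close_lifts f F -> F (x, y) -> f x = f y ->
  F (y, y') -> F (x, x') -> f x' = f y' -> F (x', y').
Proof.
move=> entF Fu Fxy fxy Fyy' Fxx' fxy'.
(* The first chain pauses at [x] while the second moves to [y] inside the fiber, so their images
   agree. *)
have /and4P[_ _ /set_mem//] : close_chains F [:: x; x; x'] [:: x; y; y'].
apply: Fu; rewrite /chain_from /= ?andbT ?mem_set// -?fxy ?fxy' //.
exact: entourage_refl.
Qed.

Lemma close_lifts_map (X Z Y : Type) (h : X -> Z) (f : X -> Y)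
    (F : set (X * X)) (s t : seq X) :
  (forall x y, F (x, y) -> f x = f y -> h x = h y) ->
  close_chains F s t -> map f s = map f t -> map h s = map h t.
Proof.
move=> hF; elim: s t => [|x s IH] [|y t] //=.
by case/andP=> /set_mem Fxy /IH st [/(hF _ _ Fxy)-> /st->].
Qed.

(** * The quotient by closeness in fibers *)

Section FiberQuotient.
Variables (X Y : uniformType) (f : X -> Y) (F : set (X * X)).
Hypotheses (entF : entourage F) (Fu : close_lifts f F).

Definition fiber_close (x y : X) : bool := `[< F (x, y) /\ f x = f y >].

Lemma fiber_close_refl : reflexive fiber_close.
Proof. by move=> x; apply/asboolP; split => //; exact: entourage_refl. Qed.

Lemma fiber_close_sym : symmetric fiber_close.
Proof.
by move=> x y; apply/idP/idP => /asboolP[Fxy fxy]; apply/asboolP;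
  split => //; exact: close_lifts_sym Fxy fxy.
Qed.

Lemma fiber_close_trans : transitive fiber_close.
Proof.
move=> y x z; rewrite fiber_close_sym.
move=> /asboolP[Fyx fyx] /asboolP[Fyz fyz]; apply/asboolP; split.
  exact: close_lifts_fiber Fu Fyx Fyz fyx fyz.
by rewrite -fyx.
Qed.

Definition fiber_equiv : equiv_rel X :=
  EquivRel fiber_close fiber_close_refl fiber_close_sym fiber_close_trans.

Definition fiber_pi : X -> {eq_quot fiber_equiv} := \pi.

Lemma fiber_piP (x y : X) : fiber_pi x = fiber_pi y <-> F (x, y) /\ f x = f y.
Proof.
split=> [/eqmodP/asboolP //|Fxy]; apply/eqmodP; exact/asboolP.
Qed.

Lemma fiber_pi_surj (z : {eq_quot fiber_equiv}) : exists x, fiber_pi x = z.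
Proof. by exists (repr z); exact: reprK. Qed.

Hypothesis f_lift : chain_lifting f.

Lemma fiber_pi_lift (E : set (X * X)) : entourage E ->
  exists2 D, entourage D & lifts_steps fiber_pi D E.
Proof.
move=> entE.
(* [E] is the size required of the lifted step; [F], imposed on both the lifted and the given step,
   lets [close_lifts_step] identify the classes of their end points. *)
have [D entD DEF] := chain_lifting_steps f_lift (filterI entE entF).
exists (D `&` F); first exact: filterI.
move=> x _ [[y y'] /= [Dyy' Fyy']] [/esym/fiber_piP[Fxy fxy] <-].
have [|x' [Exx' Fxx'] fx'] := DEF x (f y').
  by exists (y, y') => //=; rewrite fxy.
exists x' => //; apply/fiber_piP; split => //.
exact: close_lifts_step Fxy fxy Fyy' Fxx' fx'.
Qed.

Definition fiber_quotient : uniformType :=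
  image_uniform fiber_pi_surj fiber_pi_lift.

Definition fiber_quotient_pi : X -> fiber_quotient := fiber_pi.

Definition fiber_quotient_map (z : fiber_quotient) : Y :=
  f (repr (z : {eq_quot fiber_equiv})).

(** The chosen representative of the class of [x] lies in the same fiber of [f] as [x]. *)
Lemma fiber_quotient_factor : f = fiber_quotient_map \o fiber_quotient_pi.
Proof.
apply/funext => x; have /fiber_piP[_] := esym (reprK (fiber_pi x)).
exact.
Qed.

Lemma fiber_quotient_pi_generates : generates_uniformity fiber_quotient_pi.
Proof. by []. Qed.

Lemma fiber_quotient_pi_bounded : bounded_fibers F fiber_quotient_pi.
Proof. by move=> z [x y] /= [<- /esym/fiber_piP[]]. Qed.

Lemma fiber_quotient_map_unique : unique_chain_lifts fiber_quotient_map.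
Proof.
(* [D] makes quotient chains lift to [F]-chains from a common [x], to which [Fu] applies;
   intersecting with [E] only keeps the new entourage inside [A]. *)
move=> A [E entE EA]; have [D entD DF] := fiber_pi_lift entF.
exists (rel_image fiber_quotient_pi (D `&` E)); split.
- by exists (D `&` E) => //; exact: filterI.
- by apply: subset_trans EA; exact: rel_imageS.
move=> z s t; have [x <-] := fiber_pi_surj z.
move=> /(sub_chain_from (rel_imageS (@subIsetl _ _ _))).
move=> /(lifts_steps_chain DF)[s' Fs <-].
move=> /(sub_chain_from (rel_imageS (@subIsetl _ _ _))).
move=> /(lifts_steps_chain DF)[t' Ft <-].
rewrite -!map_cons -!map_comp -fiber_quotient_factor => st.
apply: close_lifts_map (Fu Fs Ft st) st => a b Fab fab.
exact/fiber_piP.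
Qed.

End FiberQuotient.

Theorem proposition2p5 (X Y : uniformType) (f : X -> Y)
    (f_gen : generates_uniformity f)
    (f_lift : chain_lifting f)
    (f_sauniq : strong_approx_unique_chain_lifts f) :
  approximated_by_uniform_covering_maps f.
Proof.
move=> E /f_sauniq[F [entF FE Fu]]; exists F; split => //.
have pi_gen := fiber_quotient_pi_generates entF Fu f_lift.
have fE := fiber_quotient_factor entF Fu f_lift.
exists (fiber_quotient entF Fu f_lift), (fiber_quotient_pi entF Fu f_lift),
  (@fiber_quotient_map _ _ _ _ entF Fu f_lift); split => //.
- exact: generates_uniformity_unif_continuous.
- exact: fiber_quotient_pi_bounded.
split; last exact: fiber_quotient_map_unique.
- by apply: generates_uniformity_compr pi_gen _; rewrite -fE.
- by apply: chain_lifting_compr pi_gen _; rewrite -fE.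
Qed.
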